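(* Let $\phi:\{0,1\}^*\to\{0,1\}^*$ be the morphism $0\mapsto 00101$, $1\mapsto 11011$, and let $\Phi=\lim_{n\to\infty}\phi^n(0)$ be its fixed point beginning with $0$. Then $\Phi$ has the Frobenius property.
   Context: For an infinite word $\mathbf{w}$, $\mathcal{L}_{\mathbf{w}}$ denotes its set of (finite) factors. A semigroup homomorphism $S:\{0,1\}^*\to\mathbb{N}$ is determined by $S(0),S(1)$ via $S(uv)=S(u)+S(v)$, and $S(\mathcal{L}_{\mathbf{w}})=\{S(u):u\in\mathcal{L}_{\mathbf{w}}\}$. An infinite binary word $\mathbf{w}$ has the Frobenius property if for every such $S$ with $S(0),S(1)$ non-negative integers satisfying $\gcd(S(0),S(1))=1$, the set $S(\mathcal{L}_{\mathbf{w}})$ contains all but finitely many elements of $\mathbb{N}$. *)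

(* Defs.v *)
From mathcomp Require Import all_boot.
From mathcomp Require Import classical_sets functions cardinality.

Set Implicit Arguments.
Unset Strict Implicit.
Unset Printing Implicit Defensive.

Local Open Scope classical_set_scope.

(* The letter 0 is [false] and the letter 1 is [true]; a finite binary word is
   a [seq bool] and an infinite binary word is a function [nat -> bool],
   indexed from 0. *)

Definition factor_at (w : nat -> bool) (i n : nat) : seq bool :=
  mkseq (fun j => w (i + j)) n.

Definition language (w : nat -> bool) : set (seq bool) :=
  [set u | exists i n, u = factor_at w i n].

(* The codomain [nat] makes S(0) and S(1) non-negative, and additivity forces
   [S [::] = 0]. *)
Definition word_hom (S : seq bool -> nat) : Prop :=
  {morph S : u v / u ++ v >-> u + v}.

Definition frobenius_property (w : nat -> bool) : Prop :=
  forall S : seq bool -> nat, word_hom S ->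
    gcdn (S [:: false]) (S [:: true]) = 1 ->
    finite_set (~` (S @` language w)).

Definition phi_letter (b : bool) : seq bool :=
  if b then [:: true; true; false; true; true]
  else [:: false; false; true; false; true].

Definition phi (u : seq bool) : seq bool := flatten (map phi_letter u).

Definition word_limit (u : nat -> seq bool) (w : nat -> bool) : Prop :=
  forall k, exists N, forall n, N <= n ->
    k <= size (u n) /\ take k (u n) = mkseq w k.

(* The i-th letter of the limit is read off the (i+1)-st iterate, which has
   length 5^(i+1) > i, so the default value of [nth] is never used;
   [Phi_limit] and [word_limit_unique] justify this definition. *)
Definition Phi (i : nat) : bool := nth false (iter i.+1 phi [:: false]) i.

Lemma phi_cat : {morph phi : u v / u ++ v}.
Proof. by move=> u v; rewrite /phi map_cat flatten_cat. Qed.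

Lemma iter_phi_cat n : {morph iter n phi : u v / u ++ v}.
Proof. by elim: n => [|n IHn] u v //; rewrite !iterS IHn phi_cat. Qed.

Lemma size_phi u : size (phi u) = 5 * size u.
Proof.
elim: u => //= b u IHu; rewrite -cat1s phi_cat size_cat IHu mulnS.
by case: b.
Qed.

Lemma size_iter_phi n u : size (iter n phi u) = 5 ^ n * size u.
Proof. by elim: n => [|n IHn] /=; rewrite ?mul1n // size_phi IHn expnS mulnA. Qed.

Lemma prefix_iter_phi m n : m <= n ->
  prefix (iter m phi [:: false]) (iter n phi [:: false]).
Proof.
elim: n => [|n IHn]; first by rewrite leqn0 => /eqP->; exact: prefix_refl.
rewrite leq_eqVlt => /predU1P[->|/IHn mn]; first exact: prefix_refl.
apply: prefix_trans mn _; rewrite iterSr.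
rewrite -[phi [:: false]]/([:: false] ++ [:: false; true; false; true]).
by rewrite iter_phi_cat prefix_prefix.
Qed.

Lemma nth_iter_phi n i : i < size (iter n phi [:: false]) ->
  nth false (iter n phi [:: false]) i = Phi i.
Proof.
have ltS : i < size (iter i.+1 phi [:: false]).
  by rewrite size_iter_phi muln1 (leq_trans (ltnSn i)) // ltnW // ltn_expl.
move=> ltn; rewrite /Phi.
case/orP: (leq_total n i.+1) => /prefix_iter_phi/prefixP[s ->];
  by rewrite nth_cat ?ltn ?ltS.
Qed.

Lemma Phi_limit : word_limit (fun n => iter n phi [:: false]) Phi.
Proof.
move=> k; exists k => n kn.
have le_k : k <= size (iter n phi [:: false]).
  by rewrite size_iter_phi muln1 (leq_trans kn) // ltnW // ltn_expl.
split=> //; apply: (@eq_from_nth _ false) => [|i].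
  by rewrite size_takel // size_mkseq.
rewrite size_takel // => ik.
by rewrite nth_take // nth_mkseq // nth_iter_phi // (leq_trans ik).
Qed.

Lemma word_limit_unique u w w' : word_limit u w -> word_limit u w' -> w =1 w'.
Proof.
move=> uw uw' i; have [N /(_ _ (leq_maxl _ _)) hN] := uw i.+1.
have [N' /(_ _ (leq_maxr _ _)) hN'] := uw' i.+1.
have [_ e] := hN N'; have [_ e'] := hN' N.
by have := congr1 (nth false ^~ i) (etrans (esym e) e'); rewrite !nth_mkseq.
Qed.

Lemma Phi_fixed n : phi (mkseq Phi n) = mkseq Phi (5 * n).
Proof.
have [N /(_ N (leqnn _)) [le_n e]] := Phi_limit n.
have eS : iter N.+1 phi [:: false] =
    phi (mkseq Phi n) ++ phi (drop n (iter N phi [:: false])).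
  by rewrite -e -phi_cat cat_take_drop.
apply: (@eq_from_nth _ false) => [|i]; first by rewrite size_phi !size_mkseq.
move=> ip; have i5 : i < 5 * n by rewrite size_phi size_mkseq in ip.
have := @nth_iter_phi N.+1 i; rewrite eS nth_cat ip size_cat => ->.
  by rewrite nth_mkseq.
by rewrite ltn_addr.
Qed.

(* Main.v *)
(** Write D(u) = 2|u|_0 - |u|_1 = 3|u|_0 - |u|.  Since phi doubles D, an
    extension by fewer than five letters gives D(5n+r) >= 2 D(n) - 2 for the
    prefixes of Phi, so D tends to infinity along prefixes; extending
    to the left instead gives D(5n+r) <= 2 D(n) + 2, so every length n >= 2
    admits a factor with D <= -2.  Sliding a window changes |u|_0
    by at most one, so for n large all values 3a - n between 0 and a given bound
    are attained by factors of length n.  Put p = S(0), q = S(1), m = p + 2q.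
    A word with a zeros and discrepancy D has m a = S(u) + q D, and q is
    invertible modulo m; hence any large N is S(u) for some factor u with
    0 <= D(u) < m. *)
Require Import Defs.
From mathcomp Require Import all_boot zify.
From mathcomp Require Import classical_sets cardinality.

Set Implicit Arguments.
Unset Strict Implicit.
Unset Printing Implicit Defensive.

Local Open Scope classical_set_scope.

Local Notation zeros := (count_mem false).

Lemma size_factor_at w i n : size (factor_at w i n) = n.
Proof. exact: size_mkseq. Qed.

Lemma factor_at_cat w i m n :
  factor_at w i (m + n) = factor_at w i m ++ factor_at w (i + m) n.
Proof.
rewrite /factor_at /mkseq iotaD map_cat add0n; congr (_ ++ _).
rewrite -[X in iota X n]addn0 iotaDl -map_comp.
by apply: eq_map => j /=; rewrite addnA.
Qed.

Lemma phi_factor_at i n :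
  phi (factor_at Phi i n) = factor_at Phi (5 * i) (5 * n).
Proof.
have /= := congr1 (drop (5 * i)) (Phi_fixed (i + n)).
rewrite -![mkseq Phi _]/(factor_at Phi 0 _) mulnDr.
rewrite (factor_at_cat _ 0 i) (factor_at_cat _ 0 (5 * i)) phi_cat !add0n.
by rewrite !drop_size_cat ?size_phi ?size_factor_at.
Qed.

(* Evaluating [Phi i] itself builds a word of length 5^(i+1); this reads short
   factors off a single iterate of phi instead. *)
Lemma factor_at_iter k i n : i + n <= 5 ^ k ->
  factor_at Phi i n = take n (drop i (iter k phi [:: false])).
Proof.
move=> le_k; have le_n : n <= size (drop i (iter k phi [:: false])).
  by rewrite size_drop size_iter_phi muln1; lia.
apply: (@eq_from_nth _ false) => [|j]; first by rewrite size_factor_at size_takel.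
rewrite size_factor_at => jn; rewrite nth_mkseq // nth_take // nth_drop.
by rewrite nth_iter_phi // size_iter_phi muln1; lia.
Qed.

(** Both blocks contain one zero, and the block of [false] two more. As phi multiplies lengths by 5,
    this says D(phi(u)) = 2 D(u). *)
Lemma zeros_phi u : zeros (phi u) = size u + 2 * zeros u.
Proof.
elim: u => //= b u IHu; rewrite -cat1s phi_cat count_cat IHu.
by case: b => /=; lia.
Qed.

Lemma zeros_take_phi_letter b r :
  r < 5 -> r <= 3 * zeros (take r (phi_letter b)) + 2.
Proof. by case: b; case: r => [|[|[|[|[|]]]]]. Qed.

Lemma zeros_drop_phi_letter b r :
  r < 5 -> 3 * zeros (drop (5 - r) (phi_letter b)) <= r + 2.
Proof. by case: b; case: r => [|[|[|[|[|]]]]]. Qed.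

Lemma factor_at_take i n r : r < 5 ->
  factor_at Phi (5 * i) (5 * n + r) =
  phi (factor_at Phi i n) ++ take r (phi_letter (Phi (i + n))).
Proof.
move=> r5; rewrite factor_at_cat phi_factor_at; congr (_ ++ _).
have := phi_factor_at (i + n) 1.
rewrite /phi /= addn0 cats0 mulnDr => ->.
rewrite -[5 * 1](@subnKC r) 1?ltnW // factor_at_cat take_size_cat //.
by rewrite size_factor_at.
Qed.

Lemma factor_at_drop i n r : r < 5 ->
  factor_at Phi (5 * i.+1 - r) (5 * n + r) =
  drop (5 - r) (phi_letter (Phi i)) ++ phi (factor_at Phi i.+1 n).
Proof.
move=> r5; rewrite addnC factor_at_cat phi_factor_at.
rewrite subnK; last by lia.
congr (_ ++ _); have := phi_factor_at i 1.
rewrite /phi /= addn0 cats0 => ->.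
rewrite -[5 * 1](@subnK r) 1?ltnW // factor_at_cat drop_size_cat ?size_factor_at //.
by congr factor_at; lia.
Qed.

(** The recursion D -> 2 D - 2 turns 3 + k into 4 + 2k, so each factor 5 in the length gains at
    least 1 once D >= 3. *)
Lemma zeros_prefix_lower k n :
  2 * 5 ^ k <= n -> n + (3 + k) <= 3 * zeros (factor_at Phi 0 n).
Proof.
have step m j r : r < 5 -> m + (3 + j) <= 3 * zeros (factor_at Phi 0 m) ->
    5 * m + r + (4 + j) <= 3 * zeros (factor_at Phi 0 (5 * m + r)).
  move=> r5 IH; rewrite -[0]/(5 * 0) factor_at_take // count_cat zeros_phi.
  rewrite size_factor_at; have := zeros_take_phi_letter (Phi (0 + m)) r5.
  by lia.
have base m : 2 <= m -> m + 3 <= 3 * zeros (factor_at Phi 0 m).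
  (* From 10 on, [m %/ 5] is still at least 2; shorter lengths are computed. *)
  elim/ltn_ind: m => m IH m2; case: (ltnP m 10) => [m10|m10].
    rewrite (@factor_at_iter 2); last by rewrite (leq_trans (ltnW m10)).
    clear IH.
    by do 10![case: m m2 m10 => [|m] m2 m10; first by move: m2; vm_compute].
  rewrite (divn_eq m 5) mulnC.
  have := @step (m %/ 5) 0 (m %% 5) (ltn_pmod _ _) (IH _ _ _); lia.
elim: k n => [|k IHk] n; first by rewrite muln1 addn0; exact: base.
rewrite expnS => kn; rewrite (divn_eq n 5) mulnC addnS -addSn.
by apply: step; [exact: ltn_pmod | apply: IHk; lia].
Qed.

(** D -> 2 D + 2 fixes -2, so the bound persists. The position is a successor so that a letter
    [Phi i] precedes the factor. *)
Lemma zeros_factor_upper n : 2 <= n ->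
  exists i, 3 * zeros (factor_at Phi i.+1 n) + 2 <= n.
Proof.
elim/ltn_ind: n => n IH n2; case: (ltnP n 10) => [n10|n10].
  have : has (fun i => 3 * zeros (take n (drop i.+1 (iter 3 phi [:: false])))
                         + 2 <= n) (iota 0 100).
    clear IH.
    by do 10![case: n n2 n10 => [|n] n2 n10; first by move: n2; vm_compute].
  case/hasP => i; rewrite mem_iota => ilt; exists i.
  by rewrite (@factor_at_iter 3) // -[5 ^ 3]/125; lia.
have [||i le_i] := IH (n %/ 5); [lia | lia |].
have r5 : n %% 5 < 5 by rewrite ltn_pmod.
exists (5 * i.+1 - n %% 5).-1; rewrite prednK; last by lia.
have := congr1 zeros (factor_at_drop i (n %/ 5) r5).
rewrite [5 * (n %/ 5)]mulnC -divn_eq count_cat zeros_phi size_factor_at => ->.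
have := zeros_drop_phi_letter (Phi i) r5; lia.
Qed.

(** Only decreases are bounded: [f] may jump over [a] upwards, but not on its way down. *)
Lemma discrete_ivt (f : nat -> nat) j a :
  (forall i, f i <= (f i.+1).+1) -> f j <= a <= f 0 -> exists i, f i = a.
Proof.
move=> step; elim: j => [|j IHj] /andP[fja af0]; first by exists 0; lia.
have [fj|afj] := leqP (f j) a; first by apply: IHj; rewrite fj.
by exists j.+1; have := step j; lia.
Qed.

Lemma zeros_factor_slide w i n :
  zeros (factor_at w i n) <= (zeros (factor_at w i.+1 n)).+1.
Proof.
have := congr1 zeros (factor_at_cat w i 1 n).
rewrite addnC factor_at_cat !count_cat addn1 /= !addn0.
by case: (w i); case: (w (i + n)) => /=; lia.
Qed.

Lemma zeros_factor_attained k n a :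
  2 * 5 ^ k <= n -> n <= 3 * a <= n + k ->
  exists i, zeros (factor_at Phi i n) = a.
Proof.
move=> kn /andP[na ak]; have ? := expn_gt0 5 k.
have [|j le_j] := @zeros_factor_upper n; first by lia.
apply: (@discrete_ivt (fun i => zeros (factor_at Phi i n)) j.+1).
  by move=> i; exact: zeros_factor_slide.
by have := zeros_prefix_lower kn; lia.
Qed.

Lemma word_homE S u : word_hom S ->
  S u = S [:: false] * zeros u + S [:: true] * (size u - zeros u).
Proof.
move=> homS; have S0 : S [::] = 0 by have := homS [::] [::]; rewrite /=; lia.
elim: u => [|b u IHu]; first by rewrite S0 !muln0.
rewrite -cat1s homS IHu; have := count_size (pred1 false) u.
case: b => /= le_u; last by rewrite add1n subSS mulnS; lia.
by rewrite add0n subSn // mulnS; lia.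
Qed.

Lemma coprime_solve q m N : 0 < m -> coprime m q ->
  exists2 d, d < m & m %| N + q * d.
Proof.
move=> m0 /eqP mq; have [a _] := Bezoutl q m0; rewrite mq => ma.
(* Here [m] divides 1 + a q, and N + q (a N) = (1 + a q) N. *)
exists ((a * N) %% m); first by rewrite ltn_pmod.
rewrite /dvdn -modnDmr modnMmr modnDmr -/(dvdn _ _).
by rewrite mulnA -mulSn mulnC [q * a]mulnC dvdn_mull.
Qed.

Theorem theorem5 : frobenius_property Phi.
Proof.
move=> S homS; set p := S [:: false]; set q := S [:: true] => pq1.
pose m := p + 2 * q.
have m0 : 0 < m.
  rewrite lt0n; apply/eqP => m_eq0; move: pq1.
  by have [-> ->] : p = 0 /\ q = 0 by lia.
have mq : coprime m q by rewrite /coprime /m addnC gcdnC gcdnMDl gcdnC pq1.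
(* The bound makes a >= 2 * 5^m + m below, so the length 3a - d, with d < m, is at least 2 * 5^m. *)
apply: (@sub_finite_set _ _ `I_(m * (2 * 5 ^ m + m))); last exact: finite_II.
move=> N /= notN; rewrite ltnNge; apply/negP => leN; apply: notN.
have [d dm /dvdnP[a am]] := coprime_solve N m0 mq.
have le_a : 2 * 5 ^ m + m <= a.
  by rewrite -(leq_pmul2r m0) -am mulnC (leq_trans leN) // leq_addr.
have [||i zi] := @zeros_factor_attained m (3 * a - d) a; [lia | lia |].
exists (factor_at Phi i (3 * a - d)); first by exists i, (3 * a - d).
rewrite (word_homE _ homS) zi size_factor_at -/p -/q.
have -> : 3 * a - d - a = 2 * a - d by lia.
(* Keeps the subtraction in p a + q (2a - d) = m a - q d = N from truncating. *)
have : q * d <= q * (2 * a) by apply: leq_mul => //; lia.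
by rewrite mulnBr; move: am; rewrite /m; lia.
Qed.
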